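(* Let $R$ be a commutative ring with identity and $n$ a positive integer. Then $$\operatorname{Int}^{(\infty)}(R[\varepsilon_1,\ldots,\varepsilon_n])=\operatorname{Int}^{(\infty)}(R,R[\varepsilon_1,\ldots,\varepsilon_n])=\operatorname{Int}^{(\infty)}(R)[\varepsilon_1,\ldots,\varepsilon_n].$$
   Context: All rings are commutative with identity. For a ring $A$, $T(A)$ is its total quotient ring (localization at all non-zerodivisors). For a subset $E\subseteq T(A)$, $\operatorname{Int}^{(\infty)}(E,A)=\{f\in T(A)[X]: f^{(j)}(E)\subseteq A\text{ for all } j\ge 0\}$, where $f^{(j)}$ is the $j$-th formal derivative, and $\operatorname{Int}^{(\infty)}(A)=\operatorname{Int}^{(\infty)}(A,A)$. $R[\varepsilon_1,\ldots,\varepsilon_n]=R[T_1,\ldots,T_n]/(T_1^2,\ldots,T_n^2)$, with $\varepsilon_i$ the image of $T_i$. It is free over $R$ with basis $\varepsilon_S=\prod_{i\in S}\varepsilon_i$, $S\subseteq\{1,\ldots,n\}$. Its total quotient ring is identified canonically with $T(R)[\varepsilon_1,\ldots,\varepsilon_n]$, so that $T(R[\varepsilon_1,\ldots,\varepsilon_n])[X]=\bigoplus_S T(R)[X]\varepsilon_S$. For a subring $B\subseteq T(R)[X]$, $B[\varepsilon_1,\ldots,\varepsilon_n]=\bigoplus_S B\varepsilon_S$. *)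

(* Defs.v *)
From HB Require Import structures.
From mathcomp Require Import all_boot all_order all_algebra.
From mathcomp Require Import boolp classical_sets.
From mathcomp Require Import mpoly ring.

Set Implicit Arguments.
Unset Strict Implicit.
Unset Printing Implicit Defensive.

Import GRing.Theory.
Local Open Scope ring_scope.
Local Open Scope quotient_scope.

Section NonZeroDivisor.
Variable A : comNzRingType.

Definition nzd : {pred A} :=
  fun s : A => `[< forall x : A, s * x = 0 -> x = 0 >].

Lemma nzdP s : reflect (forall x : A, s * x = 0 -> x = 0) (s \in nzd).
Proof. exact: asboolP. Qed.

Lemma nzd1 : 1 \in nzd.
Proof. by apply/nzdP => x; rewrite mul1r. Qed.

Lemma nzdM s t : s \in nzd -> t \in nzd -> s * t \in nzd.
Proof.
move=> /nzdP hs /nzdP ht; apply/nzdP => x.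
by rewrite -mulrA => /hs /ht.
Qed.

Lemma nzd_inj s x y : s \in nzd -> s * x = s * y -> x = y.
Proof.
move=> /nzdP hs e; apply/eqP; rewrite -subr_eq0; apply/eqP/hs.
by rewrite mulrBr e subrr.
Qed.

End NonZeroDivisor.
Arguments nzd : clear implicits.

(* As in [mathcomp.algebra.fraction], but for an arbitrary commutative ring,
   with denominators ranging over the non-zerodivisors. *)
Module TotQuot.
Section TotQuot.
Variable A : comNzRingType.

Record pair := Pair { num : A; den : A; den_nzd : den \in nzd A }.

Definition pair_val (x : pair) : A * A := (num x, den x).
Definition pair_opt (u : A * A) : option pair :=
  if boolP (u.2 \in nzd A) is AltTrue h then Some (Pair u.1 h) else None.
Lemma pair_valK : pcancel pair_val pair_opt.
Proof.
case=> a s h; rewrite /pair_opt /pair_val /=.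
by case: {-}_ / boolP => [h'|]; [rewrite (bool_irrelevance h' h) | rewrite h].
Qed.
#[export]
HB.instance Definition _ := Choice.copy pair (pcan_type pair_valK).

Implicit Types x y z : pair.

(* The usual extra factor [u] in [u * (a * t - b * s) = 0] is not needed, since
   the denominators are non-zerodivisors. *)
Definition equivp x y := num x * den y == num y * den x.

Lemma equivp_refl : reflexive equivp.
Proof. by move=> x; rewrite /equivp. Qed.

Lemma equivp_sym : ssrbool.symmetric equivp.
Proof. by move=> x y; rewrite /equivp eq_sym. Qed.

Lemma equivp_trans : transitive equivp.
Proof.
move=> y x z; rewrite /equivp => /eqP xy /eqP yz; apply/eqP.
by apply: (nzd_inj (den_nzd y)); ring: xy yz.
Qed.

Canonical equivp_equiv := EquivRel equivp equivp_refl equivp_sym equivp_trans.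

Definition type := {eq_quot equivp}.
#[export]
HB.instance Definition _ : EqQuotient _ equivp type := EqQuotient.on type.
#[export]
HB.instance Definition _ := Choice.on type.

Lemma equivpP x y :
  reflect (num x * den y = num y * den x) (x == y %[mod type]).
Proof. by rewrite eqmodE; apply: eqP. Qed.

Lemma reprE x :
  num (repr (\pi_type x)) * den x = num x * den (repr (\pi_type x)).
Proof. by apply/equivpP; rewrite reprK. Qed.

Definition addp x y :=
  Pair (num x * den y + num y * den x) (nzdM (den_nzd x) (den_nzd y)).
Definition oppp x := Pair (- num x) (den_nzd x).
Definition mulp x y := Pair (num x * num y) (nzdM (den_nzd x) (den_nzd y)).
Definition zerop := Pair 0 (nzd1 A).
Definition onep := Pair 1 (nzd1 A).

Definition zero : type := lift_cst type zerop.
Definition one : type := lift_cst type onep.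
Definition add := lift_op2 type addp.
Definition opp := lift_op1 type oppp.
Definition mul := lift_op2 type mulp.

Canonical pi_zero_morph := PiConst zero.
Canonical pi_one_morph := PiConst one.

Lemma pi_opp : {morph \pi : x / oppp x >-> opp x}.
Proof.
move=> x; unlock opp; apply/eqP/equivpP => /=.
by rewrite !mulNr reprE.
Qed.
Canonical pi_opp_morph := PiMorph1 pi_opp.

Lemma pi_add : {morph \pi : x y / addp x y >-> add x y}.
Proof.
move=> x y; unlock add; apply/eqP/equivpP => /=.
by move: (repr _) (repr _) (reprE x) (reprE y) => x' y' ex ey; ring: ex ey.
Qed.
Canonical pi_add_morph := PiMorph2 pi_add.

Lemma pi_mul : {morph \pi : x y / mulp x y >-> mul x y}.
Proof.
move=> x y; unlock mul; apply/eqP/equivpP => /=.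
by move: (repr _) (repr _) (reprE x) (reprE y) => x' y' ex ey; ring: ex ey.
Qed.
Canonical pi_mul_morph := PiMorph2 pi_mul.

Lemma addA : associative add.
Proof.
elim/quotW=> x; elim/quotW=> y; elim/quotW=> z.
by rewrite !piE; apply/eqP/equivpP => /=; ring.
Qed.

Lemma addC : commutative add.
Proof.
elim/quotW=> x; elim/quotW=> y.
by rewrite !piE; apply/eqP/equivpP => /=; ring.
Qed.

Lemma add0 : left_id zero add.
Proof.
elim/quotW=> x.
by rewrite !piE; apply/eqP/equivpP => /=; ring.
Qed.

Lemma addN : left_inverse zero opp add.
Proof.
elim/quotW=> x.
by rewrite !piE; apply/eqP/equivpP => /=; ring.
Qed.

#[export]
HB.instance Definition _ := GRing.isZmodule.Build type addA addC add0 addN.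

Lemma mulA : associative mul.
Proof.
elim/quotW=> x; elim/quotW=> y; elim/quotW=> z.
by rewrite !piE; apply/eqP/equivpP => /=; ring.
Qed.

Lemma mulC : commutative mul.
Proof.
elim/quotW=> x; elim/quotW=> y.
by rewrite !piE; apply/eqP/equivpP => /=; ring.
Qed.

Lemma mul1 : left_id one mul.
Proof.
elim/quotW=> x.
by rewrite !piE; apply/eqP/equivpP => /=; ring.
Qed.

Lemma mulDl : left_distributive mul add.
Proof.
elim/quotW=> x; elim/quotW=> y; elim/quotW=> z.
by rewrite !piE; apply/eqP/equivpP => /=; ring.
Qed.

Lemma nonzero1 : one != zero.
Proof. by rewrite piE /equivp /= !mulr1 oner_eq0. Qed.

#[export]
HB.instance Definition _ :=
  GRing.Zmodule_isComNzRing.Build type mulA mulC mul1 mulDl nonzero1.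

End TotQuot.
Module Exports. HB.reexport. End Exports.
End TotQuot.
Export TotQuot.Exports.

Notation totq := TotQuot.type.

Section TotQuotTheory.
Import TotQuot.
Variable A : comNzRingType.

Definition totq_frac (a s : A) (hs : s \in nzd A) : totq A :=
  \pi_(totq A) (Pair a hs).

Definition totq_inj (a : A) : totq A := totq_frac a (nzd1 A).

Lemma totq_frac_eq a s (hs : s \in nzd A) b t (ht : t \in nzd A) :
  (totq_frac a hs = totq_frac b ht) <-> (a * t = b * s).
Proof. by split=> [/eqP/equivpP | h]; [|apply/eqP/equivpP]. Qed.

Lemma totq_fracD a s (hs : s \in nzd A) b t (ht : t \in nzd A) :
  totq_frac a hs + totq_frac b ht = totq_frac (a * t + b * s) (nzdM hs ht).
Proof. by rewrite /totq_frac -[LHS]pi_add. Qed.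

Lemma totq_fracN a s (hs : s \in nzd A) :
  - totq_frac a hs = totq_frac (- a) hs.
Proof. by rewrite /totq_frac -[LHS]pi_opp. Qed.

Lemma totq_fracM a s (hs : s \in nzd A) b t (ht : t \in nzd A) :
  totq_frac a hs * totq_frac b ht = totq_frac (a * b) (nzdM hs ht).
Proof. by rewrite /totq_frac -[LHS]pi_mul. Qed.

Lemma totq_frac1 : 1 = totq_frac 1 (nzd1 A).
Proof. by rewrite -[LHS]/(one A) /totq_frac !piE. Qed.

Lemma totq_fracP (x : totq A) :
  exists a s (hs : s \in nzd A), x = totq_frac a hs.
Proof.
elim/quotW: x => -[a s hs]; exists a, s, hs.
by [].
Qed.

Lemma totq_inj_zmod_morphism : zmod_morphism totq_inj.
Proof.
by move=> a b; rewrite /totq_inj totq_fracN totq_fracD; apply/totq_frac_eq; ring.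
Qed.
HB.instance Definition _ :=
  GRing.isZmodMorphism.Build A (totq A) totq_inj totq_inj_zmod_morphism.

Lemma totq_inj_monoid_morphism : monoid_morphism totq_inj.
Proof.
split=> [|a b]; first by rewrite totq_frac1.
by rewrite /totq_inj totq_fracM; apply/totq_frac_eq; ring.
Qed.
HB.instance Definition _ :=
  GRing.isMonoidMorphism.Build A (totq A) totq_inj totq_inj_monoid_morphism.

Lemma totq_inj_injective : injective totq_inj.
Proof. by move=> a b /totq_frac_eq; rewrite !mulr1. Qed.

Lemma totq_fracE a s (hs : s \in nzd A) :
  totq_frac a hs * totq_inj s = totq_inj a.
Proof. by rewrite /totq_inj totq_fracM; apply/totq_frac_eq; ring. Qed.

Lemma totq_inj_inv s (hs : s \in nzd A) :
  totq_inj s * totq_frac 1 hs = 1.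
Proof. by rewrite mulrC totq_fracE rmorph1. Qed.

End TotQuotTheory.

(* A ring morphism preserving non-zerodivisors extends to total quotient
   rings, by [a / s |-> f a / f s]. *)
Section TotQuotMap.
Import TotQuot.
Variables (A B : comNzRingType) (f : {rmorphism A -> B}).
Hypothesis fnzd : {in nzd A, forall s, f s \in nzd B}.

Definition totq_map (x : totq A) : totq B :=
  totq_frac (f (num (repr x))) (fnzd (den_nzd (repr x))).

Lemma totq_map_frac a s (hs : s \in nzd A) :
  totq_map (totq_frac a hs) = totq_frac (f a) (fnzd hs).
Proof.
rewrite /totq_map; apply/totq_frac_eq; rewrite -!rmorphM; congr (f _).
exact: (reprE (Pair a hs)).
Qed.

Lemma totq_map_inj a : totq_map (totq_inj a) = totq_inj (f a).
Proof. by rewrite totq_map_frac /totq_inj; apply/totq_frac_eq; rewrite rmorph1. Qed.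

Lemma totq_map_zmod_morphism : zmod_morphism totq_map.
Proof.
move=> x y; have [a [s [hs ->]]] := totq_fracP x.
have [b [t [ht ->]]] := totq_fracP y.
rewrite totq_fracN totq_fracD !totq_map_frac totq_fracN totq_fracD.
by apply/totq_frac_eq; rewrite !rmorphD !rmorphM !rmorphN.
Qed.
HB.instance Definition _ :=
  GRing.isZmodMorphism.Build (totq A) (totq B) totq_map totq_map_zmod_morphism.

Lemma totq_map_monoid_morphism : monoid_morphism totq_map.
Proof.
split=> [|x y].
  rewrite totq_frac1 totq_map_frac [RHS]totq_frac1.
  by apply/totq_frac_eq; rewrite rmorph1.
have [a [s [hs ->]]] := totq_fracP x.
have [b [t [ht ->]]] := totq_fracP y.
rewrite totq_fracM !totq_map_frac totq_fracM.
by apply/totq_frac_eq; rewrite !rmorphM.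
Qed.
HB.instance Definition _ :=
  GRing.isMonoidMorphism.Build (totq A) (totq B) totq_map
    totq_map_monoid_morphism.

End TotQuotMap.

Section EpsIdeal.
Variables (n : nat) (R : comNzRingType).

Definition eps_ideal : {pred {mpoly R[n]}} := fun p : {mpoly R[n]} =>
  `[< exists q : 'I_n -> {mpoly R[n]}, p = \sum_(i < n) q i * 'X_i ^+ 2 >].

Lemma eps_idealP p :
  reflect (exists q : 'I_n -> {mpoly R[n]}, p = \sum_(i < n) q i * 'X_i ^+ 2)
          (p \in eps_ideal).
Proof. exact: asboolP. Qed.

Lemma eps_ideal_closed : idealr_closed eps_ideal.
Proof.
split.
- by apply/eps_idealP; exists (fun=> 0); rewrite big1 // => i _; rewrite mul0r.
- apply/negP => /eps_idealP [q] /(congr1 (meval (fun=> 0))).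
  rewrite meval1 raddf_sum big1 /=; first by move/eqP; rewrite oner_eq0.
  by move=> i _; rewrite mevalM expr2 mevalM mevalXU !mulr0.
- move=> a p p' /eps_idealP [q ->] /eps_idealP [q' ->]; apply/eps_idealP.
  exists (fun i => a * q i + q' i); rewrite mulr_sumr -big_split /=.
  by apply: eq_bigr => i _; rewrite mulrDl mulrA.
Qed.

HB.instance Definition _ := isIdealr.Build {mpoly R[n]} eps_ideal eps_ideal_closed.

Definition eps_ring := {ideal_quot eps_ideal}.
HB.instance Definition _ := GRing.ComNzRing.on eps_ring.

Definition eps_proj (p : {mpoly R[n]}) : eps_ring := \pi_eps_ring p.

Lemma eps_proj_zmod_morphism : zmod_morphism eps_proj.
Proof. by move=> p q; rewrite /eps_proj !piE. Qed.
HB.instance Definition _ :=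
  GRing.isZmodMorphism.Build {mpoly R[n]} eps_ring eps_proj
    eps_proj_zmod_morphism.

Lemma eps_proj_monoid_morphism : monoid_morphism eps_proj.
Proof. by split=> [|p q]; rewrite /eps_proj !piE. Qed.
HB.instance Definition _ :=
  GRing.isMonoidMorphism.Build {mpoly R[n]} eps_ring eps_proj
    eps_proj_monoid_morphism.

Lemma eps_proj_eq0 p : (eps_proj p = 0) <-> (p \in eps_ideal).
Proof.
rewrite -[p in X in _ <-> X]subr0 Quotient.idealrBE.
by rewrite /eps_proj -(rmorph0 eps_proj); split=> /eqP.
Qed.

Definition eps_const : R -> eps_ring := eps_proj \o @mpolyC n R.
HB.instance Definition _ := GRing.RMorphism.on eps_const.

Definition eps (i : 'I_n) : eps_ring := eps_proj 'X_i.

Definition epsS (S : {set 'I_n}) : eps_ring := \prod_(i in S) eps i.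

Lemma eps_ideal_coef p :
  (p \in eps_ideal) <->
  (forall m : 'X_{1..n}, (forall i, (m i <= 1)%N) -> p@_m = 0).
Proof.
split=> [/eps_idealP [q ->] m hm|h].
  rewrite raddf_sum big1 //= => i _.
  rewrite mcoeffM big1 // => -[k1 k2] /= /eqP mE.
  rewrite mpolyXn mcoeffX; case: eqP; rewrite ?mulr0 // => k2E.
  have := congr1 (fun m' : 'X_{1..n} => m' i) mE.
  rewrite mnmDE -k2E mulmnE mnm1E eqxx => mi.
  by have := hm i; rewrite mi addnC.
rewrite [p]mpolyE; apply: rpred_sum => m _.
case: (pickP (fun i => 1 < m i)%N) => [i lt1m|le1m]; last first.
  by rewrite h ?scale0r ?rpred0 // => i; rewrite leqNgt le1m.
have le2m : (U_(i) *+ 2 <= m)%MM.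
  apply/mnm_lepP => j; rewrite mulmnE mnm1E.
  by case: eqP => [<-|] //; rewrite mul1n.
rewrite -(submK le2m) mpolyXD -mpolyXn scalerAl.
apply: idealMr; apply/eps_idealP; exists (fun j => (j == i)%:R).
rewrite (bigD1 i) //= eqxx mul1r big1 ?addr0 // => j /negPf ->.
by rewrite mul0r.
Qed.

Lemma eps_const_nzd : {in nzd R, forall s, eps_const s \in nzd eps_ring}.
Proof.
move=> s /nzdP hs; apply/nzdP; elim/quotW => p.
rewrite -[\pi p]/(eps_proj p) -[eps_const s]/(eps_proj s%:MP) -rmorphM => /eps_proj_eq0/eps_ideal_coef h.
apply/eps_proj_eq0/eps_ideal_coef => m hm; apply: hs.
by rewrite -mcoeffCM h.
Qed.

End EpsIdeal.

Local Open Scope classical_set_scope.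

Definition in_totq (A : comNzRingType) : set (totq A) := range (@totq_inj A).
Arguments in_totq : clear implicits.

(* [Int^(oo)(E, A)], for [E] included in [T(A)]. *)
Definition Int_inf_on (A : comNzRingType) (E : set (totq A)) :
    set {poly totq A} :=
  [set f | forall (j : nat) (x : totq A), E x -> in_totq A (f^`(j)).[x]].

Definition Int_inf (A : comNzRingType) : set {poly totq A} :=
  Int_inf_on (in_totq A).
Arguments Int_inf : clear implicits.

(* [R] seen inside [T(R[eps_1, ..., eps_n])], via [R[eps_1, ..., eps_n]]. *)
Definition base_in_totq (n : nat) (R : comNzRingType) :
    set (totq (eps_ring n R)) :=
  [set totq_inj (eps_const n c) | c in [set: R]].
Arguments base_in_totq : clear implicits.

(* The canonical embedding [T(R) -> T(R[eps_1, ..., eps_n])], underlying the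
   identification of [T(R[eps_1, ..., eps_n])] with
   [T(R)[eps_1, ..., eps_n]]. *)
Definition totq_base (n : nat) (R : comNzRingType) :
    totq R -> totq (eps_ring n R) :=
  totq_map (@eps_const_nzd n R).
HB.instance Definition _ (n : nat) (R : comNzRingType) :=
  GRing.RMorphism.on (@totq_base n R).

(* [B[eps_1, ..., eps_n]], the sum of the [B eps_S], for [B] a set of
   polynomials over [T(R)]. *)
Definition eps_ext (n : nat) (R : comNzRingType) (B : set {poly totq R}) :
    set {poly totq (eps_ring n R)} :=
  [set f | exists2 g : {set 'I_n} -> {poly totq R},
     (forall S, B (g S)) &
     f = \sum_(S : {set 'I_n})
           map_poly (@totq_base n R) (g S) * (totq_inj (epsS R S))%:P].
Arguments eps_ext n {R} B.

(* Main.v *)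
Require Import Defs.
From HB Require Import structures.
From mathcomp Require Import all_boot all_order all_algebra.
From mathcomp Require Import boolp classical_sets.
From mathcomp Require Import mpoly ring.

(** The three sets are compared around a cycle of inclusions; the first one
    holds because [R] is contained in [R[eps]].

    From the second set to the third, everything is read off coordinates in the
    basis [eps_S].  The point is that every element of [T(R[eps])] is a
    combination of the [eps_S] over [T(R)] ([totq_eps_decomp]): each
    non-zerodivisor of [R[eps]] divides a non-zerodivisor of [R]
    ([nzd_dvd_const]), so denominators can be taken in [R].  Applied to the
    coefficients of a polynomial [f] over [T(R[eps])], this writes [f] as a sum
    of polynomials [g_S] over [T(R)] times [eps_S]; for [r] in [R] the
    coordinates of [f^(j)(r)] are the [g_S^(j)(r)], and an element of
    [T(R[eps])] belongs to [R[eps]] only when its coordinates belong to [R]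
    ([in_totq_coord]).

    From the third set to the first, let [g] be in [Int^(oo)(R)].  Its
    derivatives send [R] to [R]; that they send [R[eps]] to [R[eps]] follows
    from the first-order Taylor formula [h(x + y) = h(x) + h'(x) y] for
    [y^2 = 0], since every element of [R[eps]] is reached from an element of [R]
    by adding finitely many elements of square zero ([eps_sqzero_ind]).  Doing
    this one element at a time is what keeps divided powers [y^k / k!] out of
    the argument, and it is the reason why all derivatives have to be controlled
    together.  The same induction proves [nzd_dvd_const]. *)

Set Implicit Arguments.
Unset Strict Implicit.
Unset Printing Implicit Defensive.

Import GRing.Theory.
Local Open Scope ring_scope.
Local Open Scope quotient_scope.
Local Open Scope classical_set_scope.

(** * Total quotient rings *)

Section TotQuotComplements.
Variable A : comNzRingType.

Lemma totq_mulI_nzd (d : A) (x y : totq A) :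
  d \in nzd A -> x * totq_inj d = y * totq_inj d -> x = y.
Proof.
move=> hd /(congr1 (fun z => z * totq_frac 1 hd)).
by rewrite -!mulrA totq_inj_inv !mulr1.
Qed.

Lemma totq_common_den (I : finType) (t : I -> totq A) :
  exists2 d, d \in nzd A & exists a, forall i, t i * totq_inj d = totq_inj (a i).
Proof.
have /choice [u uP] i :
    exists u : A * A, u.2 \in nzd A /\ t i * totq_inj u.2 = totq_inj u.1.
  have [a [s [hs ->]]] := totq_fracP (t i).
  by exists (a, s); split=> //; apply: totq_fracE.
exists (\prod_i (u i).2).
  apply: (big_ind (fun x => x \in nzd A)) => [|x y|i _].
  - exact: nzd1.
  - exact: nzdM.
  - exact: (uP i).1.
exists (fun i => (u i).1 * \prod_(j | j != i) (u j).2) => i.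
by rewrite (bigD1 i) //= !rmorphM mulrA (uP i).2.
Qed.

Lemma in_totqD (x y : totq A) : in_totq A x -> in_totq A y -> in_totq A (x + y).
Proof. by move=> [a _ <-] [b _ <-]; exists (a + b); rewrite ?rmorphD. Qed.

Lemma in_totqM (x y : totq A) : in_totq A x -> in_totq A y -> in_totq A (x * y).
Proof. by move=> [a _ <-] [b _ <-]; exists (a * b); rewrite ?rmorphM. Qed.

End TotQuotComplements.

Lemma horner_addr_sqzero (A : comNzRingType) (p : {poly A}) (x y : A) :
  y * y = 0 -> p.[x + y] = p.[x] + p^`().[x] * y.
Proof.
move=> y2; elim/poly_ind: p => [|p c IH]; first by rewrite deriv0 !horner0; ring.
by rewrite derivMXaddC !hornerE IH; ring: y2.
Qed.

(** * The basis [eps_S] of [R[eps_1, ..., eps_n]] *)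

Section EpsBasis.
Variables (n : nat) (R : comNzRingType).
Local Notation Re := (eps_ring n R).
Local Notation const := (@eps_const n R).
Implicit Types (S T : {set 'I_n}) (c : {set 'I_n} -> R).

Definition mnmS S : 'X_{1..n} := [multinom (i \in S : nat) | i < n].

Lemma mnmS_inj : injective mnmS.
Proof.
move=> S T /(congr1 (fun m : 'X_{1..n} => m _)) eST; apply/setP => i.
by have := eST i; rewrite !mnmE; do 2!case: (i \in _).
Qed.

Lemma mnmS_le1 S i : (mnmS S i <= 1)%N.
Proof. by rewrite mnmE leq_b1. Qed.

Lemma le1_mnmS (m : 'X_{1..n}) :
  (forall i, (m i <= 1)%N) -> m = mnmS [set i | m i == 1%N].
Proof.
move=> hm; apply/mnmP => i; rewrite mnmE inE.
by have := hm i; case: (m i) => [|[]].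
Qed.

Definition lift_coord c : {mpoly R[n]} := \sum_S c S *: 'X_[mnmS S].

Lemma mcoeff_lift_coord c T : (lift_coord c)@_(mnmS T) = c T.
Proof.
rewrite raddf_sum /= (bigD1 T) //= mcoeffZ mcoeffX eqxx mulr1.
rewrite big1 ?addr0 // => S neST.
by rewrite mcoeffZ mcoeffX (inj_eq mnmS_inj) (negPf neST) mulr0.
Qed.

Lemma eps_proj_lift_coord c :
  eps_proj (lift_coord c) = \sum_S const (c S) * epsS R S.
Proof.
rewrite raddf_sum; apply: eq_bigr => S _ /=.
rewrite -mul_mpolyC rmorphM /=; congr (_ * _).
rewrite mpolyXE_id rmorph_prod /epsS [RHS]big_mkcond /=.
apply: eq_bigr => i _; rewrite mnmE.
by case: (i \in S); rewrite ?expr1 ?expr0 ?rmorph1.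
Qed.

Lemma eps_span (x : Re) : exists c, x = \sum_S const (c S) * epsS R S.
Proof.
elim/quotW: x => p; exists (fun S => p@_(mnmS S)).
rewrite -eps_proj_lift_coord -[\pi p]/(eps_proj p).
apply/eqP; rewrite -subr_eq0 -raddfB; apply/eqP/eps_proj_eq0/eps_ideal_coef.
move=> m /le1_mnmS ->.
by rewrite mcoeffB mcoeff_lift_coord subrr.
Qed.

Lemma eps_free c : \sum_S const (c S) * epsS R S = 0 -> forall S, c S = 0.
Proof.
rewrite -eps_proj_lift_coord => /eps_proj_eq0/eps_ideal_coef c0 S.
by rewrite -(mcoeff_lift_coord c) c0 //; apply: mnmS_le1.
Qed.

Lemma eps_const_eq0 r : const r = 0 -> r = 0.
Proof.
move=> /eps_proj_eq0/eps_ideal_coef /(_ 0%MM); rewrite mcoeffC eqxx mulr1.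
by apply=> i; rewrite mnm0E.
Qed.

Lemma eps_sqr (i : 'I_n) : eps R i * eps R i = 0.
Proof.
rewrite -rmorphM; apply/eps_proj_eq0/eps_idealP.
exists (fun j => (j == i)%:R); rewrite (bigD1 i) //= eqxx mul1r expr2.
by rewrite big1 ?addr0 // => j /negPf ->; rewrite mul0r.
Qed.

Lemma epsS_sqr S : S != finset.set0 -> epsS R S * epsS R S = 0.
Proof.
case/set0Pn => i iS; rewrite /epsS (bigD1 i) //=.
by rewrite mulrACA eps_sqr mul0r.
Qed.

(** All basis elements other than [eps_set0 = 1] have square zero, so summing
    the coordinates of an element one by one, starting with its constant term,
    only ever adds elements of square zero. *)
Lemma eps_sqzero_ind (P : Re -> Prop) :
  (forall r, P (const r)) ->
  (forall x y, y * y = 0 -> P x -> P (x + y)) ->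
  forall x, P x.
Proof.
move=> Pconst Pstep x; have [c ->] := eps_span x.
rewrite (bigD1 finset.set0) //= [epsS _ finset.set0]big_set0 mulr1.
apply: (big_rec (fun y => P (const (c finset.set0) + y))).
  by rewrite addr0; apply: Pconst.
move=> S y S0 Py; rewrite [_ * _ + y]addrC addrA; apply: Pstep Py.
by rewrite mulrACA epsS_sqr // mulr0.
Qed.

(** If [y^2 = 0] then [(x + y)(x - y) = x^2].  Hence [x] is a
    non-zerodivisor as soon as [x + y] is one, and from [x u = d] it follows
    that [x + y] divides [d^2]. *)
Lemma nzd_dvd_const (s : Re) : s \in nzd Re ->
  exists u, exists2 d, d \in nzd R & s * u = const d.
Proof.
elim/eps_sqzero_ind: s => [r /nzdP hr|x y y2 IH /nzdP hxy].
  exists 1, r; last by rewrite mulr1.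
  by apply/nzdP => z rz; apply/eps_const_eq0/hr; rewrite -rmorphM rz rmorph0.
have hx : x \in nzd Re.
  apply/nzdP => z xz; apply: (hxy).
  have xyz : (x - y) * z = 0 by apply: hxy; ring: xz y2.
  have yz : y * z = 0 by move: xyz; rewrite mulrBl xz sub0r => /eqP; rewrite oppr_eq0 => /eqP.
  by rewrite mulrDl xz yz addr0.
have [u [d hd xu]] := IH hx.
exists ((x - y) * u * u), (d * d); first exact: nzdM.
by rewrite rmorphM /= -xu; ring: y2.
Qed.

End EpsBasis.

(** * Coordinates in [T(R[eps_1, ..., eps_n])] *)

Section TotQuotCoord.
Variables (n : nat) (R : comNzRingType).
Local Notation Re := (eps_ring n R).
Local Notation const := (@eps_const n R).
Local Notation base := (@totq_base n R).
Implicit Types (S : {set 'I_n}) (t : {set 'I_n} -> totq R).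

Definition totq_comb t : totq Re := \sum_S base (t S) * totq_inj (epsS R S).

Lemma totq_base_inj (r : R) : base (totq_inj r) = totq_inj (const r).
Proof. exact: totq_map_inj. Qed.

Lemma totq_comb_inj (c : {set 'I_n} -> R) :
  totq_comb (fun S => totq_inj (c S)) =
  totq_inj (\sum_S const (c S) * epsS R S).
Proof.
rewrite rmorph_sum; apply: eq_bigr => S _ /=.
by rewrite totq_base_inj rmorphM.
Qed.

Lemma totq_combZ t (r : R) :
  totq_comb t * totq_inj (const r) = totq_comb (fun S => t S * totq_inj r).
Proof.
rewrite mulr_suml; apply: eq_bigr => S _.
by rewrite rmorphM /= totq_base_inj mulrAC.
Qed.

Lemma totq_combB t t' :
  totq_comb t - totq_comb t' = totq_comb (fun S => t S - t' S).
Proof.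
rewrite -sumrB; apply: eq_bigr => S _.
by rewrite rmorphB mulrBl.
Qed.

Lemma totq_eps_decomp (x : totq Re) : exists t, x = totq_comb t.
Proof.
have [a [s [hs ->]]] := totq_fracP x.
have [u [d hd su]] := nzd_dvd_const hs.
have [c auE] := eps_span (a * u).
exists (fun S => totq_frac (c S) hd).
apply: (totq_mulI_nzd (eps_const_nzd n hd)); rewrite totq_combZ.
under [in RHS]eq_fun do rewrite totq_fracE.
by rewrite totq_comb_inj -auE -su !rmorphM mulrA totq_fracE.
Qed.

Lemma totq_comb_eq0 t : totq_comb t = 0 -> forall S, t S = 0.
Proof.
have [d hd [a ta]] := totq_common_den t.
move=> t0 S; apply: (totq_mulI_nzd hd); rewrite mul0r ta.
suff -> : a S = 0 by rewrite rmorph0.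
apply: eps_free; apply: totq_inj_injective; rewrite -totq_comb_inj.
by rewrite -(funext ta) -totq_combZ t0 mul0r rmorph0.
Qed.

Lemma in_totq_coord t : in_totq Re (totq_comb t) -> forall S, in_totq R (t S).
Proof.
move=> [x _]; have [c ->] := eps_span x; rewrite -totq_comb_inj.
move=> /esym/eqP; rewrite -subr_eq0 totq_combB => /eqP tc S; exists (c S) => //.
by have /eqP := totq_comb_eq0 tc S; rewrite subr_eq0 => /eqP.
Qed.

(** * Integer-valued polynomials *)

Definition poly_comb (g : {set 'I_n} -> {poly totq R}) : {poly totq Re} :=
  \sum_S map_poly base (g S) * (totq_inj (epsS R S))%:P.

Lemma derivn_poly_comb g j :
  (poly_comb g)^`(j) = poly_comb (fun S => (g S)^`(j)).
Proof.
rewrite linear_sum; apply: eq_bigr => S _ /=.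
by rewrite ![_ * _%:P]mulrC !mul_polyC linearZ /= derivn_map.
Qed.

Lemma horner_poly_comb_base g (x : totq R) :
  (poly_comb g).[base x] = totq_comb (fun S => (g S).[x]).
Proof.
rewrite horner_sum; apply: eq_bigr => S _.
by rewrite hornerM hornerC horner_map.
Qed.

Lemma poly_comb_decomp (f : {poly totq Re}) : exists g, f = poly_comb g.
Proof.
have [t tE] := choice (fun k => totq_eps_decomp f`_k).
exists (fun S => \poly_(k < size f) t k S); apply/polyP => k.
rewrite coef_sum; case: (ltnP k (size f)) => hk.
  rewrite tE; apply: eq_bigr => S _.
  by rewrite coefMC coef_map coef_poly hk.
rewrite nth_default // big1 // => S _.
by rewrite coefMC coef_map coef_poly ltnNge hk /= rmorph0 mul0r.
Qed.

(** A statement about all derivatives at once: adding an element of square zero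
    to the argument brings in the next derivative. *)
Lemma Int_inf_map_base (g : {poly totq R}) (x : Re) : Int_inf R g ->
  forall j, in_totq Re (map_poly base g^`(j)).[totq_inj x].
Proof.
move=> gInt; elim/eps_sqzero_ind: x => [r|x y y2 IH] j.
  rewrite -totq_base_inj horner_map.
  have [|a _ <-] := gInt j (totq_inj r); first by exists r.
  by exists (const a); rewrite //= totq_base_inj.
rewrite rmorphD horner_addr_sqzero; last by rewrite -rmorphM y2 rmorph0.
rewrite deriv_map -derivnS; apply: in_totqD => //.
by apply: in_totqM => //; exists y.
Qed.

Lemma Int_inf_sub_on_base : Int_inf Re `<=` Int_inf_on (base_in_totq n R).
Proof. by move=> f fInt j _ [r _ <-]; apply: fInt; exists (const r). Qed.

Lemma Int_inf_on_base_sub_ext :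
  Int_inf_on (base_in_totq n R) `<=` eps_ext n (Int_inf R).
Proof.
move=> f; have [g ->] := poly_comb_decomp f => gInt.
exists g => // S j _ [r _ <-].
apply: (in_totq_coord (t := fun S => (g S)^`(j).[totq_inj r])).
rewrite -horner_poly_comb_base -derivn_poly_comb totq_base_inj.
by apply: gInt; exists r.
Qed.

Lemma eps_ext_sub_Int_inf : eps_ext n (Int_inf R) `<=` Int_inf Re.
Proof.
move=> _ [g gInt ->] j _ [x _ <-].
rewrite -/(poly_comb g) derivn_poly_comb horner_sum.
apply: (big_ind (in_totq Re)) => [|u v|S _].
- by exists 0; rewrite ?rmorph0.
- exact: in_totqD.
- rewrite hornerM hornerC; apply: in_totqM; last by exists (epsS R S).
  exact: Int_inf_map_base.
Qed.

End TotQuotCoord.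

Theorem corollary1p3 (R : comNzRingType) (n : nat) (n_gt0 : (0 < n)%N) :
  Int_inf (eps_ring n R) = Int_inf_on (base_in_totq n R) /\
  Int_inf_on (base_in_totq n R) = eps_ext n (Int_inf R).
Proof.
have sub1 := @Int_inf_sub_on_base n R.
have sub2 := @Int_inf_on_base_sub_ext n R.
have sub3 := @eps_ext_sub_Int_inf n R.
split; apply/seteqP; split=> // f.
  by move=> /sub2/sub3.
by move=> /sub3/sub1.
Qed.
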